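(* Let $a,b_1,b_2$ be complex parameters and let $s$ be any nonzero complex constant. In each of the following pairs, the two functions satisfy the same second order ordinary differential equation (with respect to $x$, respectively $t$): (i) $F_2(a;b_1,b_2;2b_1,2b_2;\;x,\,2-x)$ and $\displaystyle (x-2)^{-a}\,{}_2F_1\!\left(\tfrac a2,\tfrac{a+1}2-b_2;\;b_1+\tfrac12;\;\frac{x^2}{(2-x)^2}\right)$; (ii) $\displaystyle F_2\!\left(b_1+b_2-\tfrac12;\,b_1,b_2;\,2b_1,2b_2;\;-\frac{4t}{(t-1)^2},\;\frac{(1-s)(st^2-1)}{s(t-1)^2}\right)$ and $\displaystyle (1-t)^{2b_1+2b_2-1}\,{}_2F_1\!\left(b_1+b_2-\tfrac12,\,b_2;\;b_1+\tfrac12;\;st^2\right)$.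
   Context: $(\alpha)_n=\alpha(\alpha+1)\cdots(\alpha+n-1)$. Appell's series is $$F_2(a;b_1,b_2;c_1,c_2;x,y)=\sum_{n,m\ge 0}\frac{(a)_{n+m}(b_1)_n(b_2)_m}{(c_1)_n(c_2)_m\,n!\,m!}x^ny^m .$$ It satisfies the rank 4 holonomic system $$x(1-x)F_{xx}-xyF_{xy}+(c_1-(a+b_1+1)x)F_x-b_1yF_y-ab_1F=0,$$ $$y(1-y)F_{yy}-xyF_{xy}+(c_2-(a+b_2+1)y)F_y-b_2xF_x-ab_2F=0 .$$ Gauss function: ${}_2F_1(A,B;C;z)=\sum_n \frac{(A)_n(B)_n}{(C)_n n!}z^n$, satisfying Euler's equation $z(1-z)y''+(C-(A+B+1)z)y'-ABy=0$. Univariate specialization: for a holomorphic map $\Phi:t\mapsto(x(t),y(t))$ from an open subset of $\mathbf C$ to $\mathbf C^2$, $F(x(t),y(t))=F\circ\Phi$. The partial differential form under $\Phi$ of an ODE $E$ in $t$ is obtained by replacing $t$-derivatives by partial derivatives via the chain rule ($\frac{dF}{dt}=\dot xF_x+\dot yF_y$, etc.). The specialized form under $\Phi$ of a linear PDE is obtained by substituting $x=x(t),y=y(t)$ into the coefficients of the partial derivatives. $E$ follows fully from a PDE system $H$ under $\Phi$ if its partial differential form coincides with the specialized form of some PDE that follows from $H$ by algebraic and partial differentiation operations. The ODE satisfied by a univariate specialization of an Appell function is understood as one following fully from its PDE system (so it is satisfied by $F\circ\Phi$ for every solution $F$ of the system holomorphic on the image of $\Phi$). For a transformed function $\theta(t)\,f(\varphi(t))$,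 the ODE meant is the pull-back of Euler's equation of $f$ by $z=\varphi(t)$ followed by multiplication of solutions by $\theta$. *)

(* Defs.v *)
From HB Require Import structures.
From mathcomp Require Import all_boot all_order all_algebra.
From mathcomp Require Import complex.
From mathcomp Require Import all_classical all_reals all_analysis.
Import Order.TTheory GRing.Theory Num.Theory numFieldNormedType.Exports.

Set Implicit Arguments.
Unset Strict Implicit.
Unset Printing Implicit Defensive.

Local Open Scope classical_set_scope.
Local Open Scope ring_scope.

Section Operators.
Variable K : numFieldType.

(** Linear ODEs [\sum_k E k t * (d/dt)^k u = 0]. *)

Definition ode := nat -> K -> K.

Definition ode_of_order (D : set K) (n : nat) (E : ode) : Prop :=
  forall t, D t -> E n t != 0 /\ forall k, (n < k)%N -> E k t = 0.

(* An equation is unchanged by multiplication with a nonvanishing function. *)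
Definition same_ode (D : set K) (E E' : ode) : Prop :=
  exists g : K -> K, forall t, D t ->
    g t != 0 /\ forall k, E k t = g t * E' k t.

(* The composition of d/dt with the operator E. *)
Definition ode_diff (E : ode) : ode := fun k t =>
  derive1 (E k) t + (if k is k'.+1 then E k' t else 0).

(* For u t = theta t * f (phi t), the operator in t which applied to u gives
   (d^k f / dz^k) (phi t):  (1/phi' d/dt)^k o (1/theta). *)
Definition pullback_diffn (phi theta : K -> K) (k : nat) : ode :=
  iter k (fun (E : ode) l t => (derive1 phi t)^-1 * ode_diff E l t)
    (fun l t => if l is 0%N then (theta t)^-1 else 0).

(* Pull-back by z = phi t of the equation L of order at most n in z, followed
   by multiplication of the solutions by theta. *)
Definition pullback_ode (n : nat) (L : ode) (phi theta : K -> K) : ode :=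
  fun l t => \sum_(k < n.+1) L k (phi t) * pullback_diffn phi theta k l t.

Definition euler_ode (A B C : K) : ode := fun k z =>
  match k with
  | 2%N => z * (1 - z)
  | 1%N => C - (A + B + 1) * z
  | 0%N => - (A * B)
  | _ => 0
  end.

(** Linear PDEs [\sum_(i, j) P i j * d_x^i d_y^j F = 0] with polynomial
    coefficients. In [{poly {poly K}}] the outer variable ['X] is x and the
    inner one ['X%:P] is y, so that [p.[x%:P].[y]] is the value at (x, y). *)

Definition pde := nat -> nat -> {poly {poly K}}.

Definition pde_dx (P : pde) : pde := fun i j =>
  deriv (P i j) + (if i is i'.+1 then P i' j else 0).

Definition pde_dy (P : pde) : pde := fun i j =>
  map_poly (@deriv K) (P i j) + (if j is j'.+1 then P i j' else 0).

(* The PDEs with polynomial coefficients in the left ideal generated by H over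
   the rational functions in x, y: [follows_cancel] is division by c. *)
Inductive follows_from (H : set pde) : pde -> Prop :=
| follows_in P : H P -> follows_from H P
| follows_add P Q : follows_from H P -> follows_from H Q ->
    follows_from H (fun i j => P i j + Q i j)
| follows_mul c P : follows_from H P -> follows_from H (fun i j => c * P i j)
| follows_cancel c P : c != 0 -> follows_from H (fun i j => c * P i j) ->
    follows_from H P
| follows_dx P : follows_from H P -> follows_from H (pde_dx P)
| follows_dy P : follows_from H P -> follows_from H (pde_dy P).

(* A family q stands for the form \sum_(i, j) q i j t * (d_x^i d_y^j F)(x t, y t);
   this is its t-derivative by the chain rule. *)
Definition chain_diff (x y : K -> K) (q : nat -> nat -> K -> K) :
    nat -> nat -> K -> K := fun i j t =>
  derive1 (q i j) t
  + (if i is i'.+1 then derive1 x t * q i' j t else 0)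
  + (if j is j'.+1 then derive1 y t * q i j' t else 0).

(* Partial differential form under t |-> (x t, y t) of an ODE of order at
   most n. *)
Definition pd_form (x y : K -> K) (n : nat) (E : ode) :
    nat -> nat -> K -> K := fun i j t =>
  \sum_(k < n.+1) E k t *
    iter k (chain_diff x y)
      (fun i j t => if (i, j) is (0%N, 0%N) then 1 else 0) i j t.

(* The PDE with rational coefficients is (1/c) P, where the polynomial c does
   not vanish on the image of D. *)
Definition follows_fully (D : set K) (H : set pde) (x y : K -> K)
    (n : nat) (E : ode) : Prop :=
  exists (P : pde) (c : {poly {poly K}}), follows_from H P /\
    forall t, D t -> c.[(x t)%:P].[y t] != 0 /\
      forall i j, pd_form x y n E i j t =
        (P i j).[(x t)%:P].[y t] / c.[(x t)%:P].[y t].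

Definition appellF2_pde1 (a b1 c1 : K) : pde := fun i j =>
  match i, j with
  | 2%N, 0%N => 'X * (1 - 'X)
  | 1%N, 1%N => - ('X * 'X%:P)
  | 1%N, 0%N => c1%:P%:P - (a + b1 + 1)%:P%:P * 'X
  | 0%N, 1%N => - (b1%:P%:P * 'X%:P)
  | 0%N, 0%N => - (a * b1)%:P%:P
  | _, _ => 0
  end.

Definition appellF2_pde2 (a b2 c2 : K) : pde := fun i j =>
  match i, j with
  | 0%N, 2%N => 'X%:P * (1 - 'X%:P)
  | 1%N, 1%N => - ('X * 'X%:P)
  | 0%N, 1%N => c2%:P%:P - (a + b2 + 1)%:P%:P * 'X%:P
  | 1%N, 0%N => - (b2%:P%:P * 'X)
  | 0%N, 0%N => - (a * b2)%:P%:P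
  | _, _ => 0
  end.

Definition appellF2_system (a b1 b2 c1 c2 : K) : set pde :=
  [set P | P = appellF2_pde1 a b1 c1 \/ P = appellF2_pde2 a b2 c2].

End Operators.

(* The complex numbers with the topology and derivative given by their norm:
   derivability over CC R is complex differentiability. *)
Definition CC (R : realType) : numFieldType := R[i].

Section ComplexPower.
Variable R : realType.

Definition cexp (z : CC R) : CC R :=
  let: (u +i* v)%C := (z : R[i]) in
  ((expR u * cos v) +i* (expR u * sin v))%C.

(* theta is a branch on D of the multivalued function f ^ alpha, given by a
   holomorphic branch l of log f. *)
Definition power_branch (D : set (CC R)) (f : CC R -> CC R) (alpha : CC R)
    (theta : CC R -> CC R) : Prop :=
  exists l : CC R -> CC R, forall t, D t ->
    [/\ derivable l t 1, cexp (l t) = f t & theta t = cexp (alpha * l t)].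

End ComplexPower.

(* Main.v *)
(** An equation of order two in [t] follows from Appell's system under
    [t |-> (x t, y t)] as soon as its partial differential form is
    [alpha H1 + beta H2] on the curve, [H1] and [H2] being the two equations.
    The terms in [F_xx] and [F_yy] fix [alpha] and [beta], and the term in
    [F_xy] then requires
      [y x'^2 / (1 - x) + x y'^2 / (1 - y) + 2 x' y' = 0],
    which both curves satisfy; [alpha : beta] is [y : - x] on [x + y = 2] and
    [4 s y : (1 - s)^2 x] on the second curve. For [s = 1] the latter degenerates
    to [y = 0], where [H1] alone suffices. The pull-back of Euler's equation only
    involves the logarithmic derivative of [theta], which for a branch of
    [f ^ alpha] is [alpha f' / f]. *)

Require Import Defs.
From HB Require Import structures.
From mathcomp Require Import all_boot all_order all_algebra.
From mathcomp Require Import complex ring lra.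
From mathcomp Require Import all_classical all_reals all_analysis.
Import Order.TTheory GRing.Theory Num.Theory numFieldNormedType.Exports.

Set Implicit Arguments.
Unset Strict Implicit.
Unset Printing Implicit Defensive.

Local Open Scope classical_set_scope.
Local Open Scope ring_scope.

(** * Derivatives of functions of one variable *)

Section Derivatives.
Variable K : numFieldType.
Implicit Types (D : set K) (f g : K -> K) (t : K).

(* The differentiation rules of the library are about ring operations on
   functions; [eapply] only recognises the pointwise form. *)
Lemma is_derive1_cst (c t : K) : is_derive t 1 (fun=> c) 0.
Proof. exact: is_derive_cst. Qed.

Lemma is_derive1_id t : is_derive t 1 (fun u => u) 1.
Proof. exact: is_derive_id. Qed.

Lemma is_derive1D f g t (df dg : K) : is_derive t 1 f df -> is_derive t 1 g dg ->
  is_derive t 1 (fun u => f u + g u) (df + dg).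
Proof. exact: is_deriveD. Qed.

Lemma is_derive1N f t (df : K) : is_derive t 1 f df ->
  is_derive t 1 (fun u => - f u) (- df).
Proof. exact: is_deriveN. Qed.

Lemma is_derive1M f g t (df dg : K) : is_derive t 1 f df -> is_derive t 1 g dg ->
  is_derive t 1 (fun u => f u * g u) (f t * dg + g t * df).
Proof. exact: is_deriveM. Qed.

Lemma is_derive1X f n t (df : K) : is_derive t 1 f df ->
  is_derive t 1 (fun u => f u ^+ n) (n%:R * f t ^+ n.-1 * df).
Proof.
have -> : (fun u => f u ^+ n) = f ^+ n by rewrite exprfctE.
exact: is_deriveX.
Qed.

Lemma is_derive1_eq f t (df df' : K) :
  is_derive t 1 f df -> df = df' -> is_derive t 1 f df'.
Proof. by move=> + <-. Qed.

Lemma is_derive1_inv g t (dg : K) : g t != 0 -> is_derive t 1 g dg ->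
  is_derive t 1 (fun u => (g u)^-1) (- dg / g t ^+ 2).
Proof.
move=> gt0 [dg' <-]; apply: DeriveDef; first exact: derivableV.
by rewrite deriveV // /GRing.scale /= mulNr mulrC mulNr.
Qed.

Lemma is_derive1_div f g t (df dg : K) : g t != 0 ->
  is_derive t 1 f df -> is_derive t 1 g dg ->
  is_derive t 1 (fun u => f u / g u) ((df * g t - f t * dg) / g t ^+ 2).
Proof.
move=> gt0 hf /(is_derive1_inv gt0) hV.
apply: (@is_derive_eq _ _ _ _ _ _ _ _ (is_deriveM hf hV)).
by rewrite /GRing.scale /=; field.
Qed.

Lemma is_derive1_comp f g t (df dg : K) :
  is_derive t 1 f df -> is_derive (f t) 1 g dg ->
  is_derive t 1 (g \o f) (dg * df).
Proof.
move=> [/derivable1_diffP df' <-] [/derivable1_diffP dg' <-].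
have dgf : differentiable (g \o f) t by exact: differentiable_comp.
apply: DeriveDef; first exact/derivable1_diffP.
rewrite -!derive1E derive1E' // diff_comp // !derive1E' //=.
by rewrite -[X in 'd  _ _ X = _]mulr1 [LHS]linearZ mulrC.
Qed.

(** Differentiation is local. The closed forms of operator coefficients are known on [D] only, and
    openness of [D] allows them to be differentiated there. *)
Lemma derive1_in_open D f g t (dg : K) : open D -> D t ->
  (forall u, D u -> f u = g u) -> is_derive t 1 g dg -> derive1 f t = dg.
Proof.
move=> oD Dt fg gdg; rewrite derive1E -(@derive_val _ _ _ _ _ _ _ gdg).
by apply: near_eq_derive; near=> u; apply: fg; near: u; exact: open_nbhs_nbhs.
Unshelve. all: by end_near. Qed.

Lemma is_derive_derive1 f t (df : K) : is_derive t 1 f df -> derive1 f t = df.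
Proof. by move=> hf; rewrite derive1E derive_val. Qed.

(** The difference quotient multiplied through by [h], which makes the estimate trivial at [h = 0]
    and the punctured neighbourhood a full one. In this form the real estimates for [expR], [cos]
    and [sin] combine into one for [cexp]. *)
Lemma is_derive1P f t (df : K) :
  is_derive t 1 f df <->
  forall eps : K, 0 < eps ->
    \forall h \near 0, `|f (h + t) - f t - h * df| <= eps * `|h|.
Proof.
have quotE (h : K) : h != 0 ->
    `|f (h + t) - f t - h * df| =
    `|df - h^-1 *: ((f \o shift t) (h *: 1) - f t)| * `|h|.
  move=> h0; rewrite -normrM -normrN; congr (`|_|).
  by rewrite /GRing.scale /= mulr1; field.
split=> [[df1 df2] eps eps0|H].
  have /cvgrPdist_le/(_ _ eps0) : h^-1 *: ((f \o shift t) (h *: 1) - f t)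
      @[h --> 0^'] --> df by rewrite -df2.
  rewrite /dnbhs near_withinE /=; apply: filterS => h hE.
  have [->|h0] := eqVneq h 0; first by rewrite add0r subrr mul0r subrr normr0 mulr0.
  by rewrite quotE // ler_wpM2r // hE.
have cv : h^-1 *: ((f \o shift t) (h *: 1) - f t) @[h --> 0^'] --> df.
  apply/cvgrPdist_le => eps eps0; rewrite /dnbhs near_withinE /=.
  apply: filterS (H _ eps0) => h + h0.
  by rewrite quotE // ler_pM2r // normr_gt0.
by apply: DeriveDef; [apply/cvg_ex; exists df|exact: cvg_lim].
Qed.

End Derivatives.

(** * Explicit second order pull-backs and partial differential forms *)

Section Forms.
Variable K : numFieldType.
Implicit Types (D : set K) (h phi theta x y : K -> K) (t : K).

(** Here [h] is [theta' / theta]. For [u = theta * (f \o phi)], the value of [f'] at [phi] is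
    [(u' - h * u) / (phi1 * theta)]; applying [phi1^-1 * d/dt] once more gives [f''], and [theta^-1]
    is a common factor. *)
Lemma pullback_ode2E D phi phi1 phi2 theta h h1 (L : ode K) :
  open D ->
  (forall t, D t -> [/\ is_derive t 1 phi (phi1 t),
                        is_derive t 1 phi1 (phi2 t) & phi1 t != 0]) ->
  (forall t, D t -> [/\ is_derive t 1 theta (h t * theta t),
                        is_derive t 1 h (h1 t) & theta t != 0]) ->
  forall t, D t -> forall l,
    pullback_ode 2 L phi theta l t = (theta t)^-1 *
      match l with
      | 0%N => L 0%N (phi t) - L 1%N (phi t) * h t / phi1 t
               + L 2%N (phi t) * ((h t ^+ 2 - h1 t) / phi1 t ^+ 2
                                  + h t * phi2 t / phi1 t ^+ 3)
      | 1%N => L 1%N (phi t) / phi1 t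
               - L 2%N (phi t) * (2 * h t / phi1 t ^+ 2 + phi2 t / phi1 t ^+ 3)
      | 2%N => L 2%N (phi t) / phi1 t ^+ 2
      | _ => 0
      end.
Proof.
move=> oD Dphi Dtheta.
have d0 (u : K) : derive1 (fun=> 0 : K) u = 0 by exact: derive1_cst.
have phiE u : D u -> derive1 phi u = phi1 u.
  by move=> /Dphi[/is_derive_derive1].
(* The closed form is needed on all of [D], since the second iteration differentiates it. *)
have P1 u : D u -> forall l, pullback_diffn phi theta 1 l u =
    match l with 0%N => - h u / (phi1 u * theta u)
               | 1%N => (phi1 u * theta u)^-1 | _ => 0 end.
  move=> Du l; have [hth _ th0] := Dtheta _ Du; have [_ _ ph0] := Dphi _ Du.
  rewrite /= /ode_diff (phiE _ Du).
  case: l => [|[|l]]; rewrite ?d0 ?addr0 ?mulr0 ?add0r //.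
  - rewrite (is_derive_derive1 (is_derive1_inv th0 hth)).
    by field; rewrite th0 ph0.
  - by field; rewrite th0 ph0.
have P2 u : D u -> forall l, pullback_diffn phi theta 2 l u =
    match l with 0%N => ((h u ^+ 2 - h1 u) / phi1 u ^+ 2
                                  + h u * phi2 u / phi1 u ^+ 3) / theta u
               | 1%N => - (2 * h u / phi1 u ^+ 2 + phi2 u / phi1 u ^+ 3) / theta u
               | 2%N => (phi1 u ^+ 2 * theta u)^-1 | _ => 0 end.
  move=> Du l; have [hth hh th0] := Dtheta _ Du; have [hph hph1 ph0] := Dphi _ Du.
  rewrite -[LHS]/((derive1 phi u)^-1 * ode_diff (pullback_diffn phi theta 1) l u).
  rewrite /ode_diff (phiE _ Du).
  have pt0 : phi1 u * theta u != 0 by rewrite mulf_neq0.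
  have hpt : is_derive u 1 (fun v => phi1 v * theta v)
      (phi1 u * (h u * theta u) + theta u * phi2 u) by exact: is_deriveM.
  have hNh : is_derive u 1 (fun v => - h v) (- h1 u) by exact: is_deriveN.
  case: l => [|[|[|l]]]; rewrite ?P1 //.
  - rewrite (@derive1_in_open _ D _ _ u _ oD Du (fun v Dv => P1 v Dv 0%N)
      (@is_derive1_div _ _ (fun v => phi1 v * theta v) u _ _ pt0 hNh hpt)).
    by field; rewrite th0 ph0.
  - rewrite (@derive1_in_open _ D _ _ u _ oD Du (fun v Dv => P1 v Dv 1%N)
      (@is_derive1_inv _ (fun v => phi1 v * theta v) u _ pt0 hpt)).
    by field; rewrite th0 ph0.
  - rewrite (@derive1_in_open _ D _ _ u _ oD Du (fun v Dv => P1 v Dv 2%N)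
      (is_derive_cst _ _ _)).
    by field; rewrite th0 ph0.
  - rewrite (@derive1_in_open _ D _ _ u _ oD Du (fun v Dv => P1 v Dv l.+3)
      (is_derive_cst _ _ _)).
    by rewrite addr0 mulr0.
move=> t Dt l; have [_ _ th0] := Dtheta _ Dt; have [_ _ ph0] := Dphi _ Dt.
rewrite /pullback_ode !big_ord_recr big_ord0.
rewrite -[LHS]/(0 + L 0%N (phi t) * pullback_diffn phi theta 0 l t
  + L 1%N (phi t) * pullback_diffn phi theta 1 l t
  + L 2%N (phi t) * pullback_diffn phi theta 2 l t) P1 // P2 //.
by case: l => [|[|[|l]]] /=; field; rewrite th0 ?ph0.
Qed.

Lemma pd_form2E D x x1 x2 y y1 y2 (E : ode K) :
  open D ->
  (forall t, D t -> is_derive t 1 x (x1 t) /\ is_derive t 1 x1 (x2 t)) ->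
  (forall t, D t -> is_derive t 1 y (y1 t) /\ is_derive t 1 y1 (y2 t)) ->
  forall t, D t -> forall i j,
    pd_form x y 2 E i j t =
      match i, j with
      | 0%N, 0%N => E 0%N t
      | 1%N, 0%N => E 1%N t * x1 t + E 2%N t * x2 t
      | 0%N, 1%N => E 1%N t * y1 t + E 2%N t * y2 t
      | 2%N, 0%N => E 2%N t * x1 t ^+ 2
      | 1%N, 1%N => E 2%N t * (2 * x1 t * y1 t)
      | 0%N, 2%N => E 2%N t * y1 t ^+ 2
      | _, _ => 0
      end.
Proof.
move=> oD Dx Dy.
set q0 := fun (i j : nat) (t : K) => if (i, j) is (0%N, 0%N) then 1 : K else 0.
have d0 c (u : K) : derive1 (fun=> c : K) u = 0 by exact: derive1_cst.
have xE u : D u -> derive1 x u = x1 u by move=> /Dx[/is_derive_derive1].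
have yE u : D u -> derive1 y u = y1 u by move=> /Dy[/is_derive_derive1].
have Q1 u : D u -> forall i j, chain_diff x y q0 i j u =
    match i, j with 1%N, 0%N => x1 u | 0%N, 1%N => y1 u | _, _ => 0 end.
  move=> Du i j; rewrite /chain_diff xE // yE //.
  by case: i => [|[|i]]; case: j => [|[|j]];
     rewrite ?d0 ?mulr0 ?mulr1 ?addr0 ?add0r.
set q1 := chain_diff x y q0 in Q1 *.
have Q2 u : D u -> forall i j, chain_diff x y q1 i j u =
    match i, j with
    | 1%N, 0%N => x2 u | 0%N, 1%N => y2 u
    | 2%N, 0%N => x1 u ^+ 2 | 0%N, 2%N => y1 u ^+ 2
    | 1%N, 1%N => 2 * x1 u * y1 u | _, _ => 0 end.
  move=> Du i j; have [_ hx] := Dx _ Du; have [_ hy] := Dy _ Du.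
  rewrite /chain_diff xE // yE //.
  have dE : derive1 (q1 i j) u =
      match i, j with 1%N, 0%N => x2 u | 0%N, 1%N => y2 u | _, _ => 0 end.
    apply: (derive1_in_open oD Du (fun v Dv => Q1 v Dv i j)).
    by case: i => [|[|i]]; case: j => [|[|j]] //; exact: is_derive_cst.
  rewrite dE.
  by case: i {dE} => [|[|[|i]]]; case: j => [|[|[|j]]]; rewrite ?Q1 //; ring.
move=> t Dt i j.
rewrite /pd_form !big_ord_recr big_ord0.
rewrite -[LHS]/(0 + E 0%N t * q0 i j t + E 1%N t * q1 i j t
  + E 2%N t * chain_diff x y q1 i j t) Q1 // Q2 //.
by case: i => [|[|[|i]]]; case: j => [|[|[|j]]]; rewrite /q0; ring.
Qed.

(** The hypotheses compare the coefficients of the six partial derivatives of order at most two,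
    with multipliers [al] and [be] for the two equations. Both equations contain [- x y F_xy],
    whence the sum [al + be]. *)
Lemma follows_fully_appellF2 D x x1 x2 y y1 y2 (a b1 b2 c1 c2 : K)
    (E : ode K) (alpha beta c : {poly {poly K}}) :
  open D ->
  (forall t, D t -> is_derive t 1 x (x1 t) /\ is_derive t 1 x1 (x2 t)) ->
  (forall t, D t -> is_derive t 1 y (y1 t) /\ is_derive t 1 y1 (y2 t)) ->
  (forall t, D t ->
    let al := alpha.[(x t)%:P].[y t] / c.[(x t)%:P].[y t] in
    let be := beta.[(x t)%:P].[y t] / c.[(x t)%:P].[y t] in
    [/\ c.[(x t)%:P].[y t] != 0,
        [/\ E 2%N t * x1 t ^+ 2 = al * (x t * (1 - x t)),
            E 2%N t * (2 * x1 t * y1 t) = - ((al + be) * (x t * y t)) &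
            E 2%N t * y1 t ^+ 2 = be * (y t * (1 - y t))],
        E 1%N t * x1 t + E 2%N t * x2 t =
          al * (c1 - (a + b1 + 1) * x t) - be * (b2 * x t),
        E 1%N t * y1 t + E 2%N t * y2 t =
          be * (c2 - (a + b2 + 1) * y t) - al * (b1 * y t) &
        E 0%N t = - (al * (a * b1)) - be * (a * b2)]) ->
  follows_fully D (appellF2_system a b1 b2 c1 c2) x y 2 E.
Proof.
move=> oD Dx Dy DE.
exists (fun i j => alpha * appellF2_pde1 a b1 c1 i j
                   + beta * appellF2_pde2 a b2 c2 i j), c; split.
  by apply: follows_add; apply: follows_mul; apply: follows_in; [left|right].
move=> t Dt; have [cn0 [E20 E11 E02] E10 E01 E00] := DE t Dt.
split=> // i j; rewrite (pd_form2E E oD Dx Dy Dt).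
rewrite !(hornerD, hornerM).
move: (alpha.[_].[_]) (beta.[_].[_]) (c.[_].[_]) cn0 E20 E11 E02 E10 E01 E00.
move=> al be ct cn0 E20 E11 E02 E10 E01 E00.
by case: i => [|[|[|i]]]; case: j => [|[|[|j]]];
  rewrite ?E20 ?E11 ?E02 ?E10 ?E01 ?E00 /appellF2_pde1 /appellF2_pde2
    ?(hornerD, hornerN, hornerM, hornerC, hornerX); field.
Qed.

End Forms.

(** * The complex exponential and branches of complex powers *)

Section ComplexExponential.
Variable R : realType.
Implicit Types z w : CC R.

Lemma cexpD z w : cexp (z + w) = cexp z * cexp w.
Proof.
case: z w => [z1 z2] [w1 w2]; rewrite /cexp /= expRD cosD sinD.
by apply/eqP; rewrite eq_complex /=; apply/andP; split; apply/eqP; ring.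
Qed.

Lemma cexp0 : cexp (0 : CC R) = 1.
Proof. by rewrite /cexp /= expR0 cos0 sin0 mulr1 mulr0. Qed.

Lemma cexp_neq0 z : cexp z != 0.
Proof.
apply/eqP => z0; have := cexpD z (- z).
by rewrite subrr cexp0 z0 mul0r => /eqP; rewrite oner_eq0.
Qed.

(** This bounds the real and imaginary parts of [cexp h - 1 - h] at [h = u + iv]. The constant 7
    collects 2 from [(1 + u) * (cos v - 1)], 4 from [(expR u - 1) * sin v] and 1 from
    [sin v - v]. *)
Lemma real_cexp_sub1_bound (e u v : R) : 0 < e <= 1 -> `|u| <= e ->
  `|expR u - 1 - u| <= e * `|u| -> `|cos v - 1| <= e * `|v| ->
  `|sin v - v| <= e * `|v| ->
  `|expR u * cos v - 1 - u| + `|expR u * sin v - v| <= e * (`|u| + 7 * `|v|).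
Proof.
move=> /andP[e0 e1] ue hu hc hs.
have -> : expR u * cos v - 1 - u =
  (expR u - 1 - u) * cos v + (1 + u) * (cos v - 1) by ring.
have -> : expR u * sin v - v = (expR u - 1) * sin v + (sin v - v) by ring.
have c1 : `|cos v| <= 1 by rewrite ler_norml cos_geN1 cos_le1.
have ev : e * `|v| <= `|v| by rewrite ler_piMl.
have eu : e * `|u| <= `|u| by rewrite ler_piMl.
have s1 : `|sin v| <= 2 * `|v|.
  by rewrite -[sin v](subrK v) (le_trans (ler_normD _ _)) //; lra.
have u1 : `|1 + u| <= 2 by rewrite (le_trans (ler_normD _ _)) // normr1; lra.
have E1 : `|expR u - 1| <= 2 * e.
  by rewrite -[_ - 1](subrK u) (le_trans (ler_normD _ _)) //; lra.
have A1 : `|(expR u - 1 - u) * cos v| <= e * `|u| * 1 by rewrite normrM ler_pM.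
have A2 : `|(1 + u) * (cos v - 1)| <= 2 * (e * `|v|) by rewrite normrM ler_pM.
have A3 : `|(expR u - 1) * sin v| <= 2 * e * (2 * `|v|) by rewrite normrM ler_pM.
have A4 := ler_normD ((expR u - 1 - u) * cos v) ((1 + u) * (cos v - 1)).
have A5 := ler_normD ((expR u - 1) * sin v) (sin v - v).
lra.
Qed.

Lemma normc_le_add (a b : R) : `|(a +i* b)%C : CC R| <= (`|a| + `|b|)%:C%C.
Proof.
rewrite normc_def /= lecR -[leRHS]ger0_norm ?addr_ge0 // -sqrtr_sqr.
rewrite ler_wsqrtr // sqrrD !real_normK ?num_real //.
have := mulr_ge0 (normr_ge0 a) (normr_ge0 b); lra.
Qed.

Lemma normc_ge_Im z : (`|complex.Im z|%:C%C : CC R) <= `|z|.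
Proof. by rewrite normc_def lecR -sqrtr_sqr ler_wsqrtr // lerDr sqr_ge0. Qed.

(** Real and imaginary parts are bounded by the norm, so the complex ball of the same radius
    works. *)
Lemma near0_Re_Im (P : set R) : (\forall u \near 0, P u) ->
  \forall h \near (0 : CC R), P (complex.Re (h : R[i])) /\ P (complex.Im (h : R[i])).
Proof.
move=> /nbhs_ballP[d /= d0 dP].
apply/nbhs_ballP; exists (d%:C%C : CC R) => [|h] /=; first by rewrite ltcR.
rewrite /ball /= sub0r normrN => hd.
split; apply: dP; rewrite /ball /= sub0r normrN -ltcR.
  exact: le_lt_trans (normc_ge_Re _) hd.
exact: le_lt_trans (normc_ge_Im _) hd.
Qed.

(** By [cexpD] the remainder at [z] is [cexp z] times the remainder at 0, which the real estimates
    control. *)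
Lemma is_derive_cexp z : is_derive z 1 (@cexp R) (cexp z).
Proof.
apply/is_derive1P => eps eps0.
(* The constant 8 is 1 + 7: in the bound [e * (|u| + 7 * |v|)] both [|u|] and [|v|] are at most
   [|h|]. *)
have [e e01 epsE] : exists2 e : R, 0 < e <= 1 & `|cexp z| * (8 * e)%:C%C <= eps.
  (* A positive element of [CC R] has zero imaginary part, so [eps] is the real number [e1]. *)
  move: eps0; case: eps => [e1 e2]; rewrite ltcE /= => /andP[/eqP -> e10].
  rewrite normc_def; set m := Num.sqrt _; have m0 : 0 <= m by exact: sqrtr_ge0.
  exists (Num.min 1 (e1 / (8 * (m + 1)))).
    by rewrite ge_min lexx /= lt_min ltr01 /= andbT divr_gt0 // mulr_gt0 // ltr_wpDl.
  rewrite -rmorphM /= lecR.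
  have m1 : 0 < 8 * (m + 1) by lra.
  have : Num.min 1 (e1 / (8 * (m + 1))) <= e1 / (8 * (m + 1)).
    by rewrite ge_min lexx orbT.
  rewrite ler_pdivlMr //; set e := Num.min _ _ => He.
  have e0 : 0 <= e by rewrite le_min ler01 divr_ge0 // ltW.
  nra.
have e0 : 0 < e by case/andP: e01.
have hexp := is_derive_expR (0 : R); rewrite expR0 in hexp.
have hcos := is_derive_cos (0 : R); rewrite sin0 oppr0 in hcos.
have hsin := is_derive_sin (0 : R); rewrite cos0 in hsin.
have /near0_Re_Im H : \forall u \near (0 : R), [/\ `|u| <= e,
    `|expR u - 1 - u| <= e * `|u|, `|cos u - 1| <= e * `|u| &
    `|sin u - u| <= e * `|u|].
  have hu : \forall u \near (0 : R), `|u| <= e by exact: nbhs0_le.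
  move/is_derive1P: hexp => /(_ _ e0) hexp.
  move/is_derive1P: hcos => /(_ _ e0) hcos.
  move/is_derive1P: hsin => /(_ _ e0) hsin.
  apply: filterS2 (filterI hu hexp) (filterI hcos hsin) => u [] /=.
  by rewrite !addr0 expR0 cos0 sin0 mulr1 mulr0 !subr0 => ? ? [].
apply: filterS H => h [[u1 u2 _ _] [_ _ v3 v4]].
rewrite (addrC h) cexpD.
have -> : cexp z * cexp h - cexp z - h * cexp z = cexp z * (cexp h - 1 - h) by ring.
rewrite normrM (le_trans _ (ler_wpM2r (normr_ge0 h) epsE)) // -mulrA.
rewrite ler_wpM2l //.
have B := real_cexp_sub1_bound e01 u1 u2 v3 v4.
have Rh := normc_ge_Re h; have Ih := normc_ge_Im h.
case: h {u1 u2 v3 v4} B Rh Ih => u v /= B.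
rewrite normc_def /=; set m := Num.sqrt _; rewrite !lecR => Rh Ih.
apply: le_trans (_ : (`|expR u * cos v - 1 - u| + `|expR u * sin v - v|)%:C%C <= _).
  have -> : cexp ((u +i* v)%C : CC R) - 1 - (u +i* v)%C =
      ((expR u * cos v - 1 - u) +i* (expR u * sin v - v))%C.
    by apply/eqP; rewrite eq_complex /= subr0 !eqxx.
  exact: normc_le_add.
rewrite -rmorphM /= lecR (le_trans B) //; nra.
Qed.

(** Differentiating [cexp (l t) = f t] gives [l' = f' / f], and then [theta = cexp (alpha * l)] has
    logarithmic derivative [alpha * l']. *)
Lemma power_branch_derive (D : set (CC R)) f df alpha theta :
  open D -> power_branch D f alpha theta ->
  (forall t, D t -> is_derive t 1 f (df t)) ->
  forall t, D t ->
    theta t != 0 /\ is_derive t 1 theta (alpha * (df t / f t) * theta t).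
Proof.
move=> oD [l Dl] Df t Dt; have [dl fE thE] := Dl t Dt.
split; first by rewrite thE cexp_neq0.
have nD : \forall u \near t, D u by exact: open_nbhs_nbhs.
have hl : is_derive t 1 l ('D_1 l t) by exact: derivableP.
have hf : is_derive t 1 f (cexp (l t) * 'D_1 l t).
  apply: near_eq_is_derive (is_derive1_comp hl (is_derive_cexp _)).
  by apply: filterS nD => u /Dl[].
have dlE : df t / f t = 'D_1 l t.
  have := @derive_val _ _ _ _ _ _ _ (Df t Dt).
  rewrite (@derive_val _ _ _ _ _ _ _ hf) => <-.
  by rewrite fE mulrC mulKf // -fE cexp_neq0.
have hal : is_derive t 1 (fun u => alpha * l u) (alpha * 'D_1 l t).
  exact: is_deriveZ.
apply: near_eq_is_derive (_ : is_derive t 1 (fun u => cexp (alpha * l u)) _).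
  by apply: filterS nD => u /Dl[].
rewrite dlE thE mulrC.
exact: (is_derive1_comp hal (is_derive_cexp _)).
Qed.

End ComplexExponential.

(** * The two curves, for any [theta] with the prescribed logarithmic derivative *)

Section Specializations.
Variable K : numFieldType.
Implicit Types (D : set K) (theta : K -> K).

(** The derivative stays an existential variable while the rules build it; an identity of rational
    functions and the side conditions on denominators remain. Quotients are tried before products
    because a quotient is itself a product with an inverse. *)
Ltac derive_rational :=
  eapply is_derive1_eq;
  [repeat first [ eapply is_derive1_cst | eapply is_derive1_id
                | eapply is_derive1D | eapply is_derive1N | eapply is_derive1X
                | eapply is_derive1_div | eapply is_derive1M ]|].

Definition ode2 (e2 e1 e0 : K -> K) : ode K := fun k =>
  match k with 2%N => e2 | 1%N => e1 | 0%N => e0 | _ => fun=> 0 end.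

Lemma ode2_order D e2 e1 e0 :
  (forall t, D t -> e2 t != 0) -> ode_of_order D 2 (ode2 e2 e1 e0).
Proof. by move=> e20 t Dt; split; [exact: e20|case=> [|[|[|k]]]]. Qed.

(** The Gauss variable is ramified at [x = 0], takes the singular value 1 at [x = 1] and has its
    pole at [x = 2]. *)
Lemma appellF2_line_sum2 D theta (a b1 b2 : K) :
  open D ->
  (forall x, D x -> [/\ x != 0, x != 1 & x != 2]) ->
  (forall x, D x ->
    theta x != 0 /\ is_derive x 1 theta (- a * (1 / (x - 2)) * theta x)) ->
  exists E : ode K,
    [/\ ode_of_order D 2 E,
        follows_fully D (appellF2_system a b1 b2 (2 * b1) (2 * b2))
          (fun x => x) (fun x => 2 - x) 2 E
      & same_ode D E
          (pullback_ode 2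
             (euler_ode (a / 2) ((a + 1) / 2 - b2) (b1 + 1 / 2))
             (fun x => x ^+ 2 / (2 - x) ^+ 2) theta)].
Proof.
move=> oD Dn0 Dth.
have n0 x : D x -> [/\ x != 0, 1 - x != 0, x - 2 != 0 & 2 - x != 0].
  by move=> /Dn0[x0 x1 x2]; rewrite !subr_eq0 x0 x2 eq_sym x1 eq_sym x2.
(* Since [x' = 1] and [x'' = 0], the coefficients are those of [F_xx], [F_x] and [F] in
   [y H1 - x H2] at [y = 2 - x]. The coefficient of [F_y] then agrees because [x + y = 2] and
   [c_i = 2 b_i]. *)
exists (ode2 (fun x => x * (1 - x) * (2 - x))
  (fun x => (2 - x) * (2 * b1 - (a + b1 + 1) * x) + b2 * x ^+ 2)
  (fun x => - (a * b1 * (2 - x)) + a * b2 * x)); split.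
- by apply: ode2_order => x /n0[x0 x1 _ x2]; rewrite !mulf_neq0.
- apply: (@follows_fully_appellF2 _ D _ (fun=> 1) (fun=> 0) _ (fun=> -1) (fun=> 0)
    _ _ _ _ _ _ 'X%:P (- 'X) 1 oD) => [x _|x _|x Dx].
  + by split; [exact: is_derive1_id|exact: is_derive1_cst].
  + by split; [derive_rational; rewrite add0r|exact: is_derive1_cst].
  + rewrite /= !(hornerN, hornerX, hornerC).
    by split; [exact: oner_neq0|split| | |]; field.
(* The factor is the quotient of the two leading coefficients. *)
- exists (fun x => 4 * x * theta x / (2 - x)) => x Dx.
  have [x0 x1 x2 x2'] := n0 x Dx; have [th0 _] := Dth x Dx.
  split; first by rewrite !mulf_neq0 ?invr_eq0 // pnatr_eq0.
  move=> k; rewrite (@pullback_ode2E _ D _ (fun x => 4 * x / (2 - x) ^+ 3)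
    (fun x => (8 + 8 * x) / (2 - x) ^+ 4) _ (fun x => - a * (1 / (x - 2)))
    (fun x => a / (x - 2) ^+ 2)) //.
  + by case: k => [|[|[|k]]] /=; field; rewrite ?th0 ?x0 ?x1 ?x2 ?x2' ?pnatr_eq0.
  + move=> u Du; have [u0 u1 u2 u2'] := n0 u Du.
    split; last by rewrite !mulf_neq0 ?invr_eq0 ?expf_neq0 ?pnatr_eq0.
    1,2: by derive_rational; rewrite ?expf_neq0 //=; field.
  + move=> u Du; have [u0 u1 u2 u2'] := n0 u Du; have [thu0 thu] := Dth u Du.
    split=> //.
    by derive_rational; rewrite ?expf_neq0 //=; field.
Qed.

(** The Gauss variable is ramified at [t = 0] and equals 1 where [s * t ^+ 2 = 1]; the curve has its
    pole at [t = 1]. The exponent [2 b1 + 2 b2 - 1] of [theta] is [2 a]. *)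
Lemma appellF2_conic D theta (b1 b2 s : K) :
  s != 0 -> open D ->
  (forall t, D t -> [/\ t != 0, t != 1 & s * t ^+ 2 != 1]) ->
  (forall t, D t -> theta t != 0 /\
     is_derive t 1 theta ((2 * b1 + 2 * b2 - 1) * (- 1 / (1 - t)) * theta t)) ->
  exists E : ode K,
    [/\ ode_of_order D 2 E,
        follows_fully D
          (appellF2_system (b1 + b2 - 1 / 2) b1 b2 (2 * b1) (2 * b2))
          (fun t => - (4 * t / (t - 1) ^+ 2))
          (fun t => (1 - s) * (s * t ^+ 2 - 1) / (s * (t - 1) ^+ 2)) 2 E
      & same_ode D E
          (pullback_ode 2
             (euler_ode (b1 + b2 - 1 / 2) b2 (b1 + 1 / 2))
             (fun t => s * t ^+ 2) theta)].
Proof.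
move=> s0 oD Dn0 Dth; set a := b1 + b2 - 1 / 2.
have n0 t : D t -> [/\ t != 0, t - 1 != 0, 1 - t != 0,
    1 - s * t ^+ 2 != 0 & s * t ^+ 2 - 1 != 0].
  by move=> /Dn0[t0 t1 t2]; rewrite !subr_eq0 t0 t1 t2 eq_sym t1 eq_sym t2.
(* The outer coefficients come from [H1 + be H2] with [be = (1 - s) t / (1 - s t^2)]. The middle one
   is taken from the rescaled pull-back of Euler's equation: solving the [F_x] comparison for it
   would divide by [x'], which vanishes at [t = -1]. *)
exists (ode2 (fun t => - t * (t - 1) ^+ 2 / 4)
  (fun t => (4 * a * t * (t - 1) + (t - 1) ^+ 2) / 4
    - (t - 1) ^+ 2 * (b1 + 1 / 2 - (a + b2 + 1) * (s * t ^+ 2))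
      / (2 * (1 - s * t ^+ 2)))
  (fun t => - (a * b1) - a * b2 * (1 - s) * t / (1 - s * t ^+ 2))); split.
- apply: ode2_order => t /n0[t0 t1 _ _ _].
  by rewrite !mulf_neq0 ?invr_eq0 ?oppr_eq0 ?expf_neq0 ?pnatr_eq0.
- have Dx t : D t ->
      is_derive t 1 (fun t => - (4 * t / (t - 1) ^+ 2))
        (4 * (t + 1) / (t - 1) ^+ 3) /\
      is_derive t 1 (fun t => 4 * (t + 1) / (t - 1) ^+ 3)
        (- (8 * t + 16) / (t - 1) ^+ 4).
    move=> /n0[t0 t1 _ _ _].
    by split; derive_rational; rewrite ?expf_neq0 //=; field.
  have Dy t : D t ->
      is_derive t 1 (fun t => (1 - s) * (s * t ^+ 2 - 1) / (s * (t - 1) ^+ 2))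
        (2 * (1 - s) * (1 - s * t) / (s * (t - 1) ^+ 3)) /\
      is_derive t 1 (fun t => 2 * (1 - s) * (1 - s * t) / (s * (t - 1) ^+ 3))
        (2 * (1 - s) * (2 * s * t + s - 3) / (s * (t - 1) ^+ 4)).
    move=> /n0[t0 t1 _ _ _].
    by split; derive_rational; rewrite ?mulf_neq0 ?expf_neq0 //=; field;
      rewrite s0 t1.
  have [s1|s1] := eqVneq s 1.
    (* The curve lies in [y = 0], so [y] cannot serve as denominator; the multipliers are 1 and
       0. *)
    apply: (@follows_fully_appellF2 _ D _ _ _ _ _ _ _ _ _ _ _ _ 1 0 1 oD Dx Dy) => t.
    move=> /n0[t0 t1 _ t2 _]; rewrite /= !(hornerX, hornerC, horner0) /a.
    have t3 : 1 - t ^+ 2 != 0 by move: t2; rewrite s1 mul1r.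
    rewrite s1; split; [exact: oner_neq0|split| | |].
    1-6: by field; rewrite ?pnatr_eq0 ?t1 ?t3.
  have s1' : 1 - s != 0 by rewrite subr_eq0 eq_sym.
  (* Dividing by [c = y], nonzero since [s != 1] and [s * t ^+ 2 != 1], normalizes the multiplier of
     [H1] to 1. *)
  apply: (@follows_fully_appellF2 _ D _ _ _ _ _ _ _ _ _ _ _ _
    'X%:P (((1 - s) ^+ 2 / (4 * s))%:P%:P * 'X) 'X%:P oD Dx Dy) => t.
  move=> /n0[t0 t1 _ t2 t2']; rewrite /= !(hornerX, hornerC, hornerM) /a.
  split; [by rewrite !mulf_neq0 ?invr_eq0 ?mulf_neq0 ?expf_neq0|split| | |].
  1-6: by field; rewrite ?pnatr_eq0 ?s0 ?s1' ?t0 ?t1 ?t2 ?t2'.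
(* Again the quotient of the leading coefficients, that of the pull-back being
   [(1 - s t^2) / (4 s theta)]. *)
- exists (fun t => - t * (t - 1) ^+ 2 * s * theta t / (1 - s * t ^+ 2)) => t Dt.
  have [t0 t1 t1' t2 _] := n0 t Dt; have [th0 _] := Dth t Dt.
  split; first by rewrite !mulf_neq0 ?invr_eq0 ?oppr_eq0 ?expf_neq0.
  move=> k; rewrite (@pullback_ode2E _ D _ (fun t => 2 * s * t) (fun=> 2 * s)
    _ (fun t => (2 * b1 + 2 * b2 - 1) * (- 1 / (1 - t)))
    (fun t => - (2 * b1 + 2 * b2 - 1) / (1 - t) ^+ 2)) //.
  + by case: k => [|[|[|k]]] /=; rewrite /a; field;
      rewrite ?th0 ?s0 ?t0 ?t1 ?t1' ?t2 ?pnatr_eq0.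
  + move=> u Du; have [u0 u1 u1' _ _] := n0 u Du.
    split; last by rewrite !mulf_neq0 ?pnatr_eq0.
    1,2: by derive_rational; rewrite /=; field.
  + move=> u Du; have [u0 u1 u1' _ _] := n0 u Du; have [thu0 thu] := Dth u Du.
    split=> //.
    by derive_rational; rewrite ?expf_neq0 //=; field.
Qed.

End Specializations.

(** * Both pairs of functions over the complex numbers *)

Theorem theorem2p4 (R : realType) (a b1 b2 s : CC R) (hs : s != 0) :
  (forall (D : set (CC R)) (theta : CC R -> CC R),
     open D ->
     (forall x, D x -> [/\ x != 0, x != 1 & x != 2]) ->
     power_branch D (fun x => x - 2) (- a) theta ->
     exists E : ode (CC R),
       [/\ ode_of_order D 2 E,
           follows_fully D
             (appellF2_system a b1 b2 (2 * b1) (2 * b2))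
             (fun x => x) (fun x => 2 - x) 2 E
         & same_ode D E
             (pullback_ode 2
                (euler_ode (a / 2) ((a + 1) / 2 - b2) (b1 + 1 / 2))
                (fun x => x ^+ 2 / (2 - x) ^+ 2) theta)])
  /\
  (forall (D : set (CC R)) (theta : CC R -> CC R),
     open D ->
     (forall t, D t -> [/\ t != 0, t != 1 & s * t ^+ 2 != 1]) ->
     power_branch D (fun t => 1 - t) (2 * b1 + 2 * b2 - 1) theta ->
     exists E : ode (CC R),
       [/\ ode_of_order D 2 E,
           follows_fully D
             (appellF2_system (b1 + b2 - 1 / 2) b1 b2 (2 * b1) (2 * b2))
             (fun t => - (4 * t / (t - 1) ^+ 2))
             (fun t => (1 - s) * (s * t ^+ 2 - 1) / (s * (t - 1) ^+ 2)) 2 E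
         & same_ode D E
             (pullback_ode 2
                (euler_ode (b1 + b2 - 1 / 2) b2 (b1 + 1 / 2))
                (fun t => s * t ^+ 2) theta)]).
Proof.
(* In each part the branch enters through its nonvanishing and its logarithmic derivative, with
   [f' = 1] for [x - 2] and [f' = - 1] for [1 - t]. *)
split=> D theta oD Dn0 Dth.
  apply: appellF2_line_sum2 => // x Dx.
  apply: (power_branch_derive (df := fun=> 1) oD Dth) => // t _.
  by apply: is_derive1_eq (is_derive1D (is_derive1_id t) (is_derive1_cst (- 2) t)) _;
    rewrite addr0.
apply: appellF2_conic => // t Dt.
apply: (power_branch_derive (df := fun=> - 1) oD Dth) => // u _.
by apply: is_derive1_eq
  (is_derive1D (is_derive1_cst 1 u) (is_derive1N (is_derive1_id u))) _;
  rewrite add0r.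
Qed.
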